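(* Let $P$ be a convex $n$-gon ($n\ge3$) with vertices $1,2,\dots,n$ in counterclockwise order, with the fan triangulation $T$ whose diagonals are $(1,3),\dots,(1,n-1)$, each oriented away from vertex $1$. Let $\lambda_{ij}$ be the initial λ-lengths of the arcs of $T$ and $\theta_i$ the initial μ-invariant of the triangle $\Delta_i=(1,i+1,i+2)$, $1\le i\le n-2$. For $3\le k\le n$, perform the super Ptolemy flips of the arcs $(1,3),(1,4),\dots,(1,k-1)$ in this order (the flip of $(1,j)$ replaces it by $(2,j+1)$); let $\lambda_{2k}$ be the resulting λ-length of $(2,k)$ and $\boxed{12k}$ the resulting μ-invariant of the triangle $(1,2,k)$ (for $k=3$ no flip is performed and $\boxed{123}=\theta_1$). Then (a) $\displaystyle\sqrt{\frac{\lambda_{2k}}{\lambda_{12}\lambda_{1k}}}\;\boxed{12k}=\sum_{i=1}^{k-2}\mathrm{wt}(\sigma_i)$; (b) $\displaystyle\lambda_{2k}=\sum_{t\in\mathcal T_{2,k}}\mathrm{wt}(t)$.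
   Context: Algebra: λ-lengths are even invertible elements with square roots, μ-invariants are odd (anticommuting, square zero); square roots are of even elements with positive body, chosen with positive body. Super Ptolemy flip: for a diagonal $e$ oriented from $P_1$ to $R$ in a quadrilateral $P_1QRS$, with triangle $P_1RS$ (μ-invariant $\theta$) to the left of $e$ and $P_1QR$ (μ-invariant $\sigma$) to the right, and $a,b,c,d$ the λ-lengths of $P_1S,SR,RQ,QP_1$: $e$ is replaced by $f=QS$ oriented $Q\to S$ with $ef=ac+bd+\sqrt{abcd}\,\sigma\theta$, triangle $QSP_1$ (left of $f$) gets $\theta'=(\theta\sqrt{bd}+\sigma\sqrt{ac})/\sqrt{ac+bd}$, triangle $QRS$ (right of $f$) gets $\sigma'=(\sigma\sqrt{bd}-\theta\sqrt{ac})/\sqrt{ac+bd}$, and the orientation of side $SR$ is reversed (other orientations unchanged). Weights: $\mathrm{wt}(\sigma_i)=\sqrt{\lambda_{i+1,i+2}/(\lambda_{1,i+1}\lambda_{1,i+2})}\;\theta_i$ (initial λ-lengths). Super $T$-paths from $2$ to $k$ (for $k\ge4$) are taken in the sub-polygon with vertices $1,\dots,k$, triangulated by $\Delta_1,\dots,\Delta_{k-2}$. Auxiliary graph: vertices $1,\dots,k$ and new vertices $\theta_1,\dots,\theta_{k-2}$ ($\theta_i$ inside $\Delta_i$); edges: the sides of $\Delta_1,\dots,\Delta_{k-2}$, the $\sigma$-edges $\sigma_i$ joining $\theta_i$ to vertex $1$, and $\tau$-edges $\tau_{ij}$ joining $\theta_i,\theta_j$ for $i<j$. The edges $(1,i+2)$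 (position $i+\frac12$, $1\le i\le k-3$) and $\sigma_i$ (position $i$) cross $(2,k)$; no others. A super $T$-path from $2$ to $k$ is $(a_0=2,\dots,a_\ell=k\mid t_1,\dots,t_\ell)$ with $t_i$ an edge joining $a_{i-1},a_i$, pairwise distinct edges, $\ell$ odd, $t_i$ crossing $(2,k)$ for even $i$, $\sigma$-edges only at even steps and $\tau$-edges only at odd steps, and crossing edges occurring in strictly increasing position. For $k=3$, $\mathcal T_{2,3}$ consists only of the single edge $(2,3)$. The weight of a path is the product of edge weights: an arc $(i,j)$ at step $s$ contributes $\lambda_{ij}$ if $s$ is odd and $\lambda_{ij}^{-1}$ if $s$ is even, $\sigma_i$ contributes $\mathrm{wt}(\sigma_i)$, $\tau$-edges contribute $1$; odd generators are written in increasing order of index ($\theta_i$ to the left of $\theta_j$ when $i<j$). *)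

(* Defs.v *)
From HB Require Import structures.
From mathcomp Require Import all_boot all_order all_algebra zify.
From mathcomp Require Import finmap.

Set Implicit Arguments.
Unset Strict Implicit.
Unset Printing Implicit Defensive.

Import Order.TTheory GRing.Theory Num.Theory.

Local Open Scope fset_scope.
Local Open Scope ring_scope.

(* [part false] and [part true] are the even and odd parts of [A].  Grassmann
   algebras over the reals are the standard example: the body of an element is
   its degree-zero coefficient.  [ssqrt x] is constrained only for [x] even of
   positive body, where it is unique (lemma [ssqrt_uniq]); likewise [x^-1] is
   only ever used at such elements, which are units by [part_unit].
   That odd elements square to zero follows from [partC], as 2 is a unit. *)
Record superAlgebra (R : rcfType) (A : unitAlgType R) := SuperAlgebra {
  part : bool -> {pred A};
  part_submod : forall b, submod_closed (part b);
  part_split : forall x, exists y z,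
    [/\ y \in part false, z \in part true & x = y + z];
  part_disj : forall x, x \in part false -> x \in part true -> x = 0;
  part1 : 1 \in part false;
  partM : forall b c x y,
    x \in part b -> y \in part c -> x * y \in part (b (+) c);
  partC : forall b c x y,
    x \in part b -> y \in part c -> x * y = (-1) ^+ (b && c) * (y * x);
  body : {rmorphism A -> R};
  bodyZ : forall (c : R) x, body (c *: x) = c * body x;
  part_unit : forall x, x \in part false -> 0 < body x -> x \is a GRing.unit;
  ssqrt : A -> A;
  ssqrtP : forall x, x \in part false -> 0 < body x ->
    [/\ ssqrt x \in part false, 0 < body (ssqrt x) & ssqrt x ^+ 2 = x]
}.

Definition is_odd (R : rcfType) (A : unitAlgType R) (SA : superAlgebra A)
  (x : A) : bool := x \in part SA true.

Definition is_pos (R : rcfType) (A : unitAlgType R) (SA : superAlgebra A)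
  (x : A) : bool := (x \in part SA false) && (0 < body SA x).

Lemma ssqrt_uniq (R : rcfType) (A : unitAlgType R) (SA : superAlgebra A)
    (x y : A) : is_pos SA x -> is_pos SA y -> y ^+ 2 = x -> y = ssqrt SA x.
Proof.
move=> /andP[xe xp] /andP[ye yp] y2.
have [se sp s2] := ssqrtP xe xp; set s := ssqrt SA x in se sp s2 *.
have ysC : y * s = s * y by rewrite (partC ye se) expr0 mul1r.
have [_ lin] := part_submod SA false.
have yse : y + s \in part SA false by rewrite -[y]scale1r; apply: lin.
have ysU : y + s \is a GRing.unit.
  by apply: (part_unit yse); rewrite rmorphD addr_gt0.
apply/eqP; rewrite -subr_eq0; apply/eqP; apply: (mulIr ysU).
by rewrite mul0r mulrBl !mulrDr -!expr2 y2 s2 ysC opprD addrA addrK subrr.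
Qed.

(* The vertices of the n-gon are 1, ..., n in counterclockwise order; an arc
   (side or diagonal) or a triangle is the finite set of its vertices.  [src x]
   is the starting vertex of the oriented arc [x].  Only the values of [src] and
   [lam] at arcs, and of [mu] at triangles, of the triangulation matter. *)
Record decoration (A : Type) := Decoration {
  arcs : {fset {fset nat}};
  src : {fset nat} -> nat;
  lam : {fset nat} -> A;
  mu : {fset nat} -> A
}.

Definition ccw (a b c : nat) : bool :=
  [|| (a < b < c)%N, (b < c < a)%N | (c < a < b)%N].

(* The triangle prs lies to the left of p -> r iff p, r, s are counterclockwise,
   and pqr lies to its right iff p, q, r are. *)
Definition flip_quad (A : Type) (D : decoration A) (p q r s : nat) : bool :=
  [&& ccw p q r, ccw p r s,
      all (fun x => x \in arcs D)
        [:: [fset p; r]; [fset p; s]; [fset s; r]; [fset r; q]; [fset q; p]]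
    & src D [fset p; r] == p].

Definition ptolemy (R : rcfType) (A : unitAlgType R) (SA : superAlgebra A)
    (D : decoration A) (p q r s : nat) : decoration A :=
  let e := lam D [fset p; r] in
  let a := lam D [fset p; s] in
  let b := lam D [fset s; r] in
  let c := lam D [fset r; q] in
  let d := lam D [fset q; p] in
  let theta := mu D [fset p; r; s] in
  let sigma := mu D [fset p; q; r] in
  let sqr := ssqrt SA in
  {| arcs := [fset q; s] |` (arcs D `\ [fset p; r]);
     src := fun x =>
       if x == [fset q; s] then q
       else if x == [fset s; r] then (if src D x == s then r else s)
       else src D x;
     lam := fun x =>
       if x == [fset q; s] then
         (a * c + b * d + sqr (a * b * c * d) * sigma * theta) / e
       else lam D x;
     mu := fun t =>
       if t == [fset q; s; p] then
         (theta * sqr (b * d) + sigma * sqr (a * c)) / sqr (a * c + b * d)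
       else if t == [fset q; r; s] then
         (sigma * sqr (b * d) - theta * sqr (a * c)) / sqr (a * c + b * d)
       else mu D t |}.

Definition super_flip (R : rcfType) (A : unitAlgType R) (SA : superAlgebra A)
    (D : decoration A) (x : {fset nat}) (D' : decoration A) : Prop :=
  exists p q r s : nat,
    [/\ x = [fset p; r], flip_quad D p q r s & D' = ptolemy SA D p q r s].

Fixpoint super_flips (R : rcfType) (A : unitAlgType R) (SA : superAlgebra A)
    (D : decoration A) (xs : seq {fset nat}) (D' : decoration A) : Prop :=
  if xs is x :: xs' then
    exists2 D1, super_flip SA D x D1 & super_flips SA D1 xs' D'
  else D' = D.

Definition fan_arcs (n : nat) : {fset {fset nat}} :=
  [fset [fset 1%N; j] | j in iota 2 n.-1] `|`
  [fset [fset j; j.+1] | j in iota 2 n.-2].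

Definition Delta (i : nat) : {fset nat} := [fset 1%N; i.+1; i.+2].

(* The orientation of the boundary sides is left arbitrary. *)
Definition fan_decoration (R : rcfType) (A : unitAlgType R)
    (SA : superAlgebra A) (n : nat) (D : decoration A) : Prop :=
  [/\ arcs D = fan_arcs n,
      forall x, x \in arcs D -> src D x \in x,
      forall j, (3 <= j <= n.-1)%N -> src D [fset 1%N; j] = 1%N,
      forall x, x \in arcs D -> is_pos SA (lam D x)
    & forall i, (1 <= i <= n - 2)%N -> is_odd SA (mu D (Delta i))].

Lemma fset2_eq (a b c d : nat) : ([fset a; b] == [fset c; d]) =
  ((a == c) && (b == d)) || ((a == d) && (b == c)).
Proof.
apply/eqP/idP => [h|]; last by case/orP => /andP[/eqP-> /eqP->] //; rewrite fsetUC.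
move/fsetP: h => h.
have := h a; have := h b; have := h c; have := h d.
rewrite !inE !eqxx /=; lia.
Qed.

Definition fan_flip_inv (A : Type) n j (D : decoration A) :=
  [/\ [fset 2%N; j] \in arcs D, [fset 1%N; 2%N] \in arcs D,
   forall i, (j <= i <= n)%N -> [fset 1%N; i] \in arcs D,
   forall i, (j <= i < n)%N -> [fset i; i.+1] \in arcs D &
   forall i, (j <= i < n)%N -> src D [fset 1%N; i] = 1%N].

Lemma super_flips_ex (R : rcfType) (A : unitAlgType R) (SA : superAlgebra A)
    n m j (D : decoration A) :
  (3 <= j)%N -> (j + m <= n)%N -> fan_flip_inv n j D ->
  exists2 D', super_flips SA D [seq [fset 1%N; i] | i <- iota j m] D'
    & fan_flip_inv n (j + m)%N D'.
Proof.
elim: m j D => [|m IH] j D j3 jm ID; first by (exists D; [reflexivity|rewrite addn0]).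
case: (ID) => h2j h12 h1 hs hsrc.
have [] := IH j.+1 (ptolemy SA D 1 2 j j.+1); rewrite ?addSnnS //=; first lia.
  split => /=.
  - by rewrite !inE eqxx.
  - by rewrite !inE h12 !fset2_eq; lia.
  - by move=> i hi; rewrite !inE h1 ?fset2_eq; lia.
  - by move=> i hi; rewrite !inE hs ?fset2_eq; lia.
  - by move=> i hi; rewrite !fset2_eq hsrc ?ifF //; lia.
move=> D' fD' ID'; exists D' => //; exists (ptolemy SA D 1 2 j j.+1) => //.
exists 1%N, 2%N, j, j.+1; split=> //.
rewrite /flip_quad /ccw /= hsrc ?eqxx; last lia.
rewrite !h1; try lia.
rewrite (fsetUC [fset j.+1]) hs; last lia.
rewrite (fsetUC [fset j]) h2j (fsetUC [fset 2%N]) h12; lia.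
Qed.

Lemma fan_super_flips_ex (R : rcfType) (A : unitAlgType R)
    (SA : superAlgebra A) n k (D : decoration A) :
  (3 <= k <= n)%N -> fan_decoration SA n D ->
  exists D', super_flips SA D [seq [fset 1%N; i] | i <- iota 3 (k - 3)] D'.
Proof.
move=> hk [hA _ hsrc _ _].
suff: fan_flip_inv n 3 D by move=> H; have [|D' ? _] := @super_flips_ex R A SA n (k-3) 3 D isT _ H; [lia|exists D'].
have h1 j : (2 <= j <= n)%N -> [fset 1%N; j] \in arcs D.
  by move=> hj; rewrite hA inE; apply/orP; left; apply/imfsetP; exists j; rewrite //= mem_iota; lia.
have h2 j : (2 <= j < n)%N -> [fset j; j.+1] \in arcs D.
  by move=> hj; rewrite hA inE; apply/orP; right; apply/imfsetP; exists j; rewrite //= mem_iota; lia.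
split; first by apply: h2; lia.
- by apply: h1; lia.
- by move=> i hi; apply: h1; lia.
- by move=> i hi; apply: h2; lia.
case=> [|[|[|i]]] // hi; apply: hsrc; lia.
Qed.

Definition wt_sigma (R : rcfType) (A : unitAlgType R) (SA : superAlgebra A)
    (D : decoration A) (i : nat) : A :=
  ssqrt SA (lam D [fset i.+1; i.+2] /
            (lam D [fset 1%N; i.+1] * lam D [fset 1%N; i.+2]))
  * mu D (Delta i).

(* [inl j] is the polygon vertex j and [inr i] the vertex theta_i in Delta_i. *)
Definition gvertex : Type := (nat + nat)%type.

Inductive gedge : Type :=
  | Arc of nat & nat
  | Sigma of nat
  | Tau of nat & nat.

Definition gedge_code (e : gedge) : (nat * nat) + (nat + nat * nat) :=
  match e with
  | Arc i j => inl (i, j)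
  | Sigma i => inr (inl i)
  | Tau i j => inr (inr (i, j))
  end.

Definition gedge_decode (c : (nat * nat) + (nat + nat * nat)) : gedge :=
  match c with
  | inl ij => Arc ij.1 ij.2
  | inr (inl i) => Sigma i
  | inr (inr ij) => Tau ij.1 ij.2
  end.

Lemma gedge_codeK : cancel gedge_code gedge_decode.
Proof. by case. Qed.

HB.instance Definition _ := Countable.copy gedge (can_type gedge_codeK).

Definition is_gedge (k : nat) (e : gedge) : bool :=
  match e with
  | Arc i j => [&& 1 <= i, i < j, j <= k & (i == 1) || (j == i.+1)]%N
  | Sigma i => (1 <= i <= k - 2)%N
  | Tau i j => [&& 1 <= i, i < j & j <= k - 2]%N
  end.

Definition ends (e : gedge) : gvertex * gvertex :=
  match e with
  | Arc i j => (inl i, inl j)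
  | Sigma i => (inr i, inl 1%N)
  | Tau i j => (inr i, inr j)
  end.

Definition joins (e : gedge) (x y : gvertex) : bool :=
  (ends e == (x, y)) || (ends e == (y, x)).

Definition is_sigma (e : gedge) : bool := if e is Sigma _ then true else false.
Definition is_tau (e : gedge) : bool := if e is Tau _ _ then true else false.

(* Twice the position at which [e] crosses (2,k), or [None] if it does not:
   sigma_i is at i, and (1, i+2) with 1 <= i <= k-3 at i + 1/2. *)
Definition crossing (k : nat) (e : gedge) : option nat :=
  match e with
  | Arc i j =>
      if (i == 1%N) && (3 <= j <= k.-1)%N then Some (j - 2).*2.+1 else None
  | Sigma i => Some i.*2
  | Tau _ _ => None
  end.

Definition Tpath : Type := (seq gvertex * seq gedge)%type.

Definition tvert (w : Tpath) (s : nat) : gvertex := nth (inl 0%N) w.1 s.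
(* Steps are numbered from 1. *)
Definition tstep (w : Tpath) (s : nat) : gedge := nth (Arc 0 0) w.2 s.-1.

Record super_Tpath_gen (k : nat) (w : Tpath) : Prop := SuperTpathGen {
  Tpath_size : size w.1 = (size w.2).+1;
  Tpath_start : tvert w 0 = inl 2;
  Tpath_end : tvert w (size w.2) = inl k;
  Tpath_edges : forall s, (1 <= s <= size w.2)%N ->
    is_gedge k (tstep w s) && joins (tstep w s) (tvert w s.-1) (tvert w s);
  Tpath_uniq : uniq w.2;
  Tpath_odd : odd (size w.2);
  Tpath_cross : forall s, (1 <= s <= size w.2)%N -> ~~ odd s ->
    crossing k (tstep w s) != None;
  Tpath_sigma : forall s, (1 <= s <= size w.2)%N ->
    is_sigma (tstep w s) -> ~~ odd s;
  Tpath_tau : forall s, (1 <= s <= size w.2)%N ->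
    is_tau (tstep w s) -> odd s;
  Tpath_increasing : forall s s' x x', (1 <= s < s')%N -> (s' <= size w.2)%N ->
    crossing k (tstep w s) = Some x -> crossing k (tstep w s') = Some x' ->
    (x < x')%N
}.

Definition super_Tpath (k : nat) (w : Tpath) : Prop :=
  if k == 3%N then w = ([:: inl 2%N; inl 3%N], [:: Arc 2 3])
  else super_Tpath_gen k w.

(* The arc factors are even, hence central; the odd factors wt(sigma_i) come
   after them, in increasing order of i. *)
Definition wt_Tpath (R : rcfType) (A : unitAlgType R) (SA : superAlgebra A)
    (D : decoration A) (k : nat) (w : Tpath) : A :=
  (\prod_(1 <= s < (size w.2).+1)
     if tstep w s is Arc i j then
       (if odd s then lam D [fset i; j] else (lam D [fset i; j])^-1)
     else 1)
  * \prod_(1 <= i < k.-1 | Sigma i \in w.2) wt_sigma SA D i.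

(* Main.v *)
Require Import Defs.
From mathcomp Require Import all_boot all_order all_algebra zify.
From mathcomp Require Import finmap.
Set Implicit Arguments.
Unset Strict Implicit.
Unset Printing Implicit Defensive.
Import Order.TTheory GRing.Theory Num.Theory.
Local Open Scope fset_scope.
Local Open Scope ring_scope.

(* Put M_k = lambda_{2k} / (lambda_{12} lambda_{1k}),
   h_i = lambda_{i+1,i+2} / (lambda_{1,i+1} lambda_{1,i+2}), w_i = wt(sigma_i)
   and S_k = sqrt(M_k) [12k].  In these coordinates the flip of (1,k) becomes
   M_{k+1} = M_k + h_{k-1} + S_k w_{k-1} and S_{k+1} = S_k + w_{k-1}, where the
   second equation holds because the nilpotent part S_k w_{k-1} of M_{k+1}
   annihilates the numerator of the new mu-invariant.  Hence S_k = sum_i w_i and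
   M_k = sum_i h_i + sum_{i<j} w_i w_j.

   On the other side, a super T-path standing at vertex 1 after an even number
   of steps must finish with the edge (1,k): any other arc (1,j) would have to
   be used again at the next step.  So for k >= 4 there is exactly one path for
   each Delta_i, of weight lambda_{12} lambda_{1k} h_i, and one for each pair
   i < j, of weight lambda_{12} lambda_{1k} w_i w_j. *)

(** * Parity, body and square roots in a superalgebra; the normalized flip *)

Section SuperAlgebraTheory.
Context {R : rcfType} {A : unitAlgType R} (SA : superAlgebra A).
Implicit Types (b : bool) (x y z t : A).

Lemma part0 b : 0 \in part SA b.
Proof. by case: (part_submod SA b). Qed.

Lemma partD b x y :
  x \in part SA b -> y \in part SA b -> x + y \in part SA b.
Proof.
by move=> hx hy; case: (part_submod SA b) => _ /(_ 1 _ _ hx hy); rewrite scale1r.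
Qed.

Lemma partZ b (c : R) x : x \in part SA b -> c *: x \in part SA b.
Proof.
move=> hx; case: (part_submod SA b) => _ /(_ c _ _ hx (part0 b)).
by rewrite addr0.
Qed.

Lemma partB b x y :
  x \in part SA b -> y \in part SA b -> x - y \in part SA b.
Proof. by move=> hx hy; rewrite partD // -scaleN1r partZ. Qed.

Lemma even_comm x y : x \in part SA false -> GRing.comm x y.
Proof.
move=> hx; have [y0 [y1 [hy0 hy1 ->]]] := part_split SA y.
by rewrite /GRing.comm mulrDr mulrDl (partC hx hy0) (partC hx hy1) !mul1r.
Qed.

(** If [z] is the odd part of [x^-1], then [x * z = 1 - x * y] is both odd and even, hence zero. *)
Lemma evenV x : x \in part SA false -> x \is a GRing.unit ->
  x^-1 \in part SA false.
Proof.
move=> hx ux; have [y [z [hy hz xV]]] := part_split SA x^-1.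
suff z0 : z = 0 by rewrite xV z0 addr0.
have xz : x * z = 1 - x * y by rewrite -(divrr ux) xV mulrDr addrAC subrr add0r.
apply: (mulrI ux); rewrite mulr0; apply: (part_disj (s := SA)).
  by rewrite xz partB ?(part1 SA) //; apply: (partM hx hy).
exact: (partM hx hz).
Qed.

Lemma odd_sqr0 x : is_odd SA x -> x * x = 0.
Proof.
move=> hx; have := partC hx hx; rewrite expr1 mulN1r => /eqP.
rewrite -addr_eq0 -mulr2n -scaler_nat scaler_eq0 pnatr_eq0 /=.
by move/eqP.
Qed.

Lemma odd_anticomm x y : is_odd SA x -> is_odd SA y -> x * y = - (y * x).
Proof. by move=> hx hy; rewrite (partC hx hy) expr1 mulN1r. Qed.

Lemma body_odd x : is_odd SA x -> body SA x = 0.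
Proof.
move=> /odd_sqr0 /(congr1 (body SA)).
by rewrite rmorphM rmorph0 => /eqP; rewrite mulf_eq0 orbb => /eqP.
Qed.

Lemma pos_comm x y : is_pos SA x -> x * y = y * x.
Proof. by case/andP=> hx _; apply: even_comm. Qed.

Lemma pos_mulrACA x y z t : is_pos SA y -> x * y * (z * t) = x * z * (y * t).
Proof. by move=> py; rewrite -!mulrA [y * (z * t)]mulrA (pos_comm _ py) !mulrA. Qed.

Lemma pos_unit x : is_pos SA x -> x \is a GRing.unit.
Proof. by case/andP=> hx ?; apply: part_unit hx _. Qed.

Lemma posD x y : is_pos SA x -> is_pos SA y -> is_pos SA (x + y).
Proof.
by case/andP=> ? ? /andP[? ?]; rewrite /is_pos partD // rmorphD addr_gt0.
Qed.

Lemma posM x y : is_pos SA x -> is_pos SA y -> is_pos SA (x * y).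
Proof.
case/andP=> hx ? /andP[hy ?]; rewrite /is_pos rmorphM mulr_gt0 // andbT.
exact: (partM hx hy).
Qed.

Lemma posV x : is_pos SA x -> is_pos SA x^-1.
Proof.
move=> px; have ux := pos_unit px; case/andP: px => hx bx.
by rewrite /is_pos evenV //= rmorphV // invr_gt0.
Qed.

Lemma pos_ssqrt x : is_pos SA x -> is_pos SA (ssqrt SA x).
Proof. by case/andP=> hx bx; have [? ? _] := ssqrtP hx bx; apply/andP. Qed.

Lemma sqr_ssqrt x : is_pos SA x -> ssqrt SA x ^+ 2 = x.
Proof. by case/andP=> hx bx; have [] := ssqrtP hx bx. Qed.

Lemma posM_odd x y : is_pos SA x -> is_odd SA y -> is_odd SA (x * y).
Proof. by case/andP=> hx _ hy; apply: (partM hx hy). Qed.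

(** A product of two odd elements has body zero, so adding it preserves invertibility and the
    existence of a root. *)
Lemma pos_add_oddM x y z :
  is_pos SA x -> is_odd SA y -> is_odd SA z -> is_pos SA (x + y * z).
Proof.
case/andP=> hx bx hy hz.
rewrite /is_pos partD //=; last exact: (partM hy hz).
by rewrite rmorphD rmorphM (body_odd hy) mul0r addr0.
Qed.

(** The difference of the roots times their sum is [x - y], and the sum is a unit. This discards a
    nilpotent term under a root when [z] annihilates it. *)
Lemma ssqrt_mul_congr x y z : is_pos SA x -> is_pos SA y ->
  x * z = y * z -> ssqrt SA x * z = ssqrt SA y * z.
Proof.
move=> px py xyz; have px' := pos_ssqrt px; have py' := pos_ssqrt py.
have xBy : (ssqrt SA x + ssqrt SA y) * (ssqrt SA x - ssqrt SA y) = x - y.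
  rewrite mulrBr !mulrDl -!expr2 !sqr_ssqrt // (pos_comm (ssqrt SA y) px').
  by rewrite opprD addrA addrK.
apply: (mulrI (pos_unit (posD px' py'))); apply/eqP.
by rewrite -subr_eq0 -mulrBr -mulrBl mulrA xBy mulrBl xyz subrr.
Qed.

(* With [g] and [h] the square roots of [c / (d e)] and [b / (e a)] and [r] that
   of [d e a], the roots in the flip formulas become [sqrt (b d) = h r],
   [sqrt (a c) = g r] and [sqrt (a c + b d) = sqrt (g^2 + h^2) r]. *)
Lemma ptolemy_normalized (a b c d e sigma theta : A)
    (f := (a * c + b * d + ssqrt SA (a * b * c * d) * sigma * theta) / e)
    (theta' := (theta * ssqrt SA (b * d) + sigma * ssqrt SA (a * c))
               / ssqrt SA (a * c + b * d))
    (S := ssqrt SA (c / (d * e)) * sigma)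
    (T := ssqrt SA (b / (e * a)) * theta) :
  is_pos SA a -> is_pos SA b -> is_pos SA c -> is_pos SA d -> is_pos SA e ->
  is_odd SA sigma -> is_odd SA theta ->
  [/\ is_pos SA f, is_odd SA theta',
      f / (d * a) = c / (d * e) + b / (e * a) + S * T
    & ssqrt SA (f / (d * a)) * theta' = S + T].
Proof.
move=> pa pb pc pd pe osigma otheta.
have pde := posM pd pe; have pea := posM pe pa; have pda := posM pd pa.
have pdea := posM pde pa.
have pM := posM pc (posV pde); have pm := posM pb (posV pea).
set g := ssqrt SA (c / (d * e)) in S *; set h := ssqrt SA (b / (e * a)) in T *.
pose r := ssqrt SA (d * e * a).
have pg : is_pos SA g := pos_ssqrt pM.
have ph : is_pos SA h := pos_ssqrt pm.
have pr : is_pos SA r := pos_ssqrt pdea.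
have r2 : r * r = d * e * a by rewrite -expr2 sqr_ssqrt.
have cE : c = g * g * (d * e) by rewrite -expr2 sqr_ssqrt // divrK // pos_unit.
have bE : b = h * h * (e * a) by rewrite -expr2 sqr_ssqrt // divrK // pos_unit.
have pgr := posM pg pr; have phr := posM ph pr.
have gr2 : (g * r) * (g * r) = (g * g) * (r * r) by rewrite (pos_mulrACA _ _ _ pr).
have hr2 : (h * r) * (h * r) = (h * h) * (r * r) by rewrite (pos_mulrACA _ _ _ pr).
have acE : a * c = (g * r) ^+ 2 by rewrite expr2 gr2 r2 cE (pos_comm _ pa) !mulrA.
have bdE : b * d = (h * r) ^+ 2.
  by rewrite expr2 hr2 r2 bE -mulrA -(pos_comm (e * a) pd) !mulrA.
have abcdE : a * b * c * d = ((g * r) * (h * r)) ^+ 2.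
  by rewrite expr2 (pos_mulrACA _ _ _ phr) -!expr2 -acE -bdE -[a * b * c]mulrA
    (pos_comm c pb) !mulrA.
pose q := ssqrt SA (g ^+ 2 + h ^+ 2).
have pgh : is_pos SA (g ^+ 2 + h ^+ 2) by rewrite posD // expr2 posM.
have pq : is_pos SA q := pos_ssqrt pgh.
have sumE : a * c + b * d = (g ^+ 2 + h ^+ 2) * (r * r).
  by rewrite acE bdE !expr2 gr2 hr2 mulrDl.
have oS : is_odd SA S := posM_odd pg osigma.
have oT : is_odd SA T := posM_odd ph otheta.
have fE : f = (g ^+ 2 + h ^+ 2 + S * T) * (d * a).
  apply: (canLR (mulrK (pos_unit pe))).
  (* By uniqueness of roots, the root of [a b c d] is [(g r) (h r)]. *)
  rewrite sumE abcdE -(ssqrt_uniq _ (posM pgr phr) erefl); last first.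
    by rewrite expr2 !posM.
  rewrite -[RHS]mulrA -[d * a * e]mulrA -(pos_comm a pe) [d * _]mulrA -r2 [RHS]mulrDl.
  congr (_ + _); rewrite /S /T -(pos_mulrACA g sigma _ ph) (pos_mulrACA _ _ _ pr).
  rewrite -[_ * sigma * theta]mulrA -[_ * (sigma * theta)]mulrA.
  by rewrite (pos_comm (sigma * theta) (posM pr pr)) [LHS]mulrA.
have theta'E : theta' = (T + S) / q.
  rewrite /theta' sumE acE bdE.
  rewrite -!(ssqrt_uniq _ _ erefl) ?expr2 ?posM //.
  rewrite -(ssqrt_uniq (y := q * r) _ _) ?posM // ?posD // ?posM //; last first.
    by rewrite expr2 (pos_mulrACA _ _ _ pr) -[q * q]expr2 sqr_ssqrt.
  rewrite invrM ?pos_unit // !mulrA -(pos_comm theta ph) -(pos_comm sigma pg).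
  by rewrite -mulrDl mulrK // pos_unit.
have pf : is_pos SA f by rewrite fE posM // pos_add_oddM.
have fdaE : f / (d * a) = g ^+ 2 + h ^+ 2 + S * T.
  by rewrite fE mulrK // pos_unit.
split=> //.
- by rewrite theta'E -(pos_comm _ (posV pq)) posM_odd ?posV // /is_odd partD.
- by rewrite fdaE !sqr_ssqrt.
have pghST : is_pos SA (g ^+ 2 + h ^+ 2 + S * T) by apply: pos_add_oddM.
rewrite fdaE theta'E (ssqrt_mul_congr pghST pgh).
  by rewrite -/q (pos_comm _ pq) divrK ?pos_unit // addrC.
(* It remains that [S T] annihilates [T + S]: [S] and [T] anticommute and square to zero. *)
rewrite mulrDl -[RHS]addr0; congr (_ + _).
rewrite mulrA mulrDr -mulrA (odd_sqr0 oT) mulr0 add0r (odd_anticomm oS oT).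
by rewrite mulNr -mulrA (odd_sqr0 oS) mulr0 oppr0 mul0r.
Qed.
End SuperAlgebraTheory.

(** * The invariant of the successive fan flips *)

Section FanFlips.
Context {R : rcfType} {A : unitAlgType R} (SA : superAlgebra A).
Implicit Types (D : decoration A) (n i m : nat).

(** The h-length of [Delta i] at vertex 1; [wt_sigma] carries its square root. *)
Definition hlen D i : A :=
  lam D [fset i.+1; i.+2] / (lam D [fset 1%N; i.+1] * lam D [fset 1%N; i.+2]).

(* The state after the flips of (1,3), ..., (1,i), when the next arc to
   be flipped is (1,i+1). *)
Record flipped_fan n D0 i D : Prop := FlippedFan {
  flipped_arcs : forall x, x \in arcs D ->
    [\/ x = [fset 1%N; 2%N], exists2 j, (i < j)%N & x = [fset 1%N; j],
        exists2 j, (3 <= j)%N & x = [fset 2%N; j]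
      | exists2 j, (2 <= j)%N & x = [fset j; j.+1]];
  flipped_src : forall j, (i < j < n)%N -> src D [fset 1%N; j] = 1%N;
  flipped_lam1 : forall j, lam D [fset 1%N; j] = lam D0 [fset 1%N; j];
  flipped_lamS : forall j, (i < j)%N ->
    lam D [fset j; j.+1] = lam D0 [fset j; j.+1];
  flipped_mu : forall j, (i <= j)%N -> mu D (Delta j) = mu D0 (Delta j);
  flipped_pos : is_pos SA (lam D [fset 2%N; i.+1]);
  flipped_odd : is_odd SA (mu D [fset 1%N; 2%N; i.+1]);
  flipped_lam2 :
    lam D [fset 2%N; i.+1] / (lam D0 [fset 1%N; 2%N] * lam D0 [fset 1%N; i.+1])
    = \sum_(1 <= j < i) hlen D0 j
      + \sum_(1 <= j < i) \sum_(1 <= l < j) wt_sigma SA D0 l * wt_sigma SA D0 j;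
  flipped_mu2 :
    ssqrt SA (lam D [fset 2%N; i.+1]
              / (lam D0 [fset 1%N; 2%N] * lam D0 [fset 1%N; i.+1]))
    * mu D [fset 1%N; 2%N; i.+1] = \sum_(1 <= j < i) wt_sigma SA D0 j
}.

(** [super_flip] only asserts that some quadrilateral exists. The orientation of the diagonal gives
    [p = 1]; then the cyclic order and the possible arcs leave one choice for [q] and [s]. *)
Lemma flipped_quad n D0 i D p q r s : (2 <= i)%N -> (i.+1 < n)%N ->
  flipped_fan n D0 i D -> [fset 1%N; i.+1] = [fset p; r] ->
  flip_quad D p q r s -> [/\ p = 1%N, q = 2%N, r = i.+1 & s = i.+2].
Proof.
move=> i2 lt_in FD epr; rewrite /flip_quad -epr (flipped_src FD) ?leqnn //.
case/and4P=> pqr prs + /eqP p1; rewrite -{p}p1 in epr pqr prs *.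
move/eqP: epr; rewrite fset2_eq eqxx /= => er.
have {er} er : r = i.+1 by move: er => /orP[/eqP ->|]; lia.
rewrite {r}er in pqr prs *; rewrite /= andbT => /and5P[_ hs hsr _ hq].
have hq2 : q = 2%N.
  case: (flipped_arcs FD hq) => [|[j hj]|[j hj]|[j hj]] /eqP;
    rewrite fset2_eq; move: pqr; rewrite /ccw; lia.
have hs2 : s = i.+2.
  case: (flipped_arcs FD hsr) => [|[j hj]|[j hj]|[j hj]] /eqP;
    rewrite fset2_eq; move: prs; rewrite /ccw; lia.
by split.
Qed.

(** Each fan flip assigns new mu-invariants only to triangles containing vertex 2, so those of the
    later [Delta i] survive. *)
Lemma Delta_neq (x : {fset nat}) i : (2 <= i)%N ->
  2%N \in x -> (Delta i == x) = false.
Proof. by move=> i2 x2; apply/eqP => eDx; move: x2; rewrite -eDx !inE; lia. Qed.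

Lemma fan_lam1_pos n D0 j : fan_decoration SA n D0 -> (2 <= j <= n)%N ->
  is_pos SA (lam D0 [fset 1%N; j]).
Proof.
case=> arcsE _ _ pos _ jn; apply: pos; rewrite arcsE inE; apply/orP; left.
by apply/imfsetP; exists j; rewrite //= mem_iota; lia.
Qed.

Lemma fan_lamS_pos n D0 j : fan_decoration SA n D0 -> (2 <= j < n)%N ->
  is_pos SA (lam D0 [fset j; j.+1]).
Proof.
case=> arcsE _ _ pos _ jn; apply: pos; rewrite arcsE inE; apply/orP; right.
by apply/imfsetP; exists j; rewrite //= mem_iota; lia.
Qed.

Lemma flipped_fan0 n D0 : (3 <= n)%N -> fan_decoration SA n D0 ->
  flipped_fan n D0 2 D0.
Proof.
move=> n3 fanD0; have [arcsE _ srcE _ odd_mu] := fanD0; split=> //.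
- move=> x; rewrite arcsE inE => /orP[] /imfsetP[j /=]; rewrite mem_iota => hj ->.
    have [->|j2] := eqVneq j 2%N; first by constructor 1.
    by constructor 2; exists j => //; lia.
  by constructor 4; exists j => //; lia.
- by move=> j hj; apply: srcE; lia.
- by apply: (fan_lamS_pos fanD0); lia.
- by apply: (odd_mu 1%N); lia.
- by rewrite !big_nat1 big_geq // addr0.
- by rewrite big_nat1.
Qed.

(** In [ptolemy_normalized], [c / (d e)] and [b / (e a)] are here M_{i+1} and h_i, while [S] and [T]
    are S_{i+1} and w_i; its two identities are thus the recursions for M and S. *)
Lemma flipped_fanS n D0 i D D' : (2 <= i)%N -> (i.+1 < n)%N ->
  fan_decoration SA n D0 -> flipped_fan n D0 i D ->
  super_flip SA D [fset 1%N; i.+1] D' -> flipped_fan n D0 i.+1 D'.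
Proof.
move=> i2 lt_in fanD0 FD [p [q [r [s [epr Q ->]]]]].
have [-> -> -> ->] := flipped_quad i2 lt_in FD epr Q => {p q r s epr Q}.
have [_ _ _ _ odd_mu] := fanD0.
have pa : is_pos SA (lam D [fset 1%N; i.+2]).
  by rewrite (flipped_lam1 FD) (fan_lam1_pos fanD0) //; lia.
have pb : is_pos SA (lam D [fset i.+2; i.+1]).
  by rewrite fsetUC (flipped_lamS FD) // (fan_lamS_pos fanD0) //; lia.
have pc : is_pos SA (lam D [fset i.+1; 2%N]).
  by rewrite fsetUC (flipped_pos FD).
have pd : is_pos SA (lam D [fset 2%N; 1%N]).
  by rewrite fsetUC (flipped_lam1 FD) (fan_lam1_pos fanD0) //; lia.
have pe : is_pos SA (lam D [fset 1%N; i.+1]).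
  by rewrite (flipped_lam1 FD) (fan_lam1_pos fanD0) //; lia.
have osigma : is_odd SA (mu D [fset 1%N; 2%N; i.+1]) := flipped_odd FD.
have otheta : is_odd SA (mu D [fset 1%N; i.+1; i.+2]).
  by rewrite -[[fset _; _; _]]/(Delta i) (flipped_mu FD) ?odd_mu //; lia.
have [pf otheta' fE theta'E] := ptolemy_normalized pa pb pc pd pe osigma otheta.
have lam2E : lam (ptolemy SA D 1 2 i.+1 i.+2) [fset 2%N; i.+2] =
    (lam D [fset 1%N; i.+2] * lam D [fset i.+1; 2%N] +
     lam D [fset i.+2; i.+1] * lam D [fset 2%N; 1%N] +
     ssqrt SA (lam D [fset 1%N; i.+2] * lam D [fset i.+2; i.+1] *
       lam D [fset i.+1; 2%N] * lam D [fset 2%N; 1%N]) *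
     mu D [fset 1%N; 2%N; i.+1] * mu D [fset 1%N; i.+1; i.+2])
    / lam D [fset 1%N; i.+1] by rewrite /= eqxx.
have mu2E : mu (ptolemy SA D 1 2 i.+1 i.+2) [fset 1%N; 2%N; i.+2] =
   (mu D [fset 1%N; i.+1; i.+2] *
      ssqrt SA (lam D [fset i.+2; i.+1] * lam D [fset 2%N; 1%N]) +
    mu D [fset 1%N; 2%N; i.+1] *
      ssqrt SA (lam D [fset 1%N; i.+2] * lam D [fset i.+1; 2%N]))
   / ssqrt SA (lam D [fset 1%N; i.+2] * lam D [fset i.+1; 2%N] +
               lam D [fset i.+2; i.+1] * lam D [fset 2%N; 1%N]).
  (* [ptolemy] lists the vertices of this triangle in another order. *)
  by rewrite /= ifT //; apply/eqP/fsetP => x; rewrite !inE; lia.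
have dE : lam D [fset 2%N; 1%N] = lam D0 [fset 1%N; 2%N].
  by rewrite fsetUC (flipped_lam1 FD).
have cE : lam D [fset i.+1; 2%N] = lam D [fset 2%N; i.+1] by rewrite fsetUC.
have bE : lam D [fset i.+2; i.+1] = lam D0 [fset i.+1; i.+2].
  by rewrite fsetUC (flipped_lamS FD).
have thetaE : mu D [fset 1%N; i.+1; i.+2] = mu D0 (Delta i).
  by rewrite -[[fset _; _; _]]/(Delta i) (flipped_mu FD).
rewrite -lam2E in pf fE theta'E; rewrite -mu2E in otheta' theta'E.
rewrite bE cE dE thetaE !(flipped_lam1 FD) (flipped_mu2 FD) in fE theta'E.
rewrite -/(wt_sigma SA D0 i) in fE theta'E.
split=> //.
- move=> x; rewrite /= !inE => /orP[/eqP->|/andP[xn xD]].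
    by constructor 3; exists i.+2 => //; lia.
  case: (flipped_arcs FD xD) => [|[j hj xE]|[j hj]|[j hj]].
  + by constructor 1.
  + constructor 2; exists j => //; move: xn; rewrite xE fset2_eq; lia.
  + by constructor 3; exists j.
  + by constructor 4; exists j.
- by move=> j hj /=; rewrite !fset2_eq (flipped_src FD) ?ifF //; lia.
- by move=> j; rewrite /= fset2_eq /= (flipped_lam1 FD).
- by move=> j hj; rewrite /= fset2_eq ifF ?(flipped_lamS FD) //; lia.
- move=> j hj; rewrite /= !Delta_neq ?(flipped_mu FD) ?inE //; lia.
- rewrite fE (flipped_lam2 FD) !(big_nat_recr i) /=; try lia.
  (* The new term S_{i+1} w_i expands to the inner sum for [j = i]. *)
  by rewrite mulr_suml -/(hlen D0 i) [RHS]addrACA !addrA.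
- by rewrite theta'E big_nat_recr //=; lia.
Qed.

Lemma super_flips_flipped_fan n D0 m i D D' : (2 <= i)%N -> (i + m < n)%N ->
  fan_decoration SA n D0 -> flipped_fan n D0 i D ->
  super_flips SA D [seq [fset 1%N; j] | j <- iota i.+1 m] D' ->
  flipped_fan n D0 (i + m) D'.
Proof.
move=> + + fanD0; elim: m i D => [|m IHm] i D i2 imn FD /=.
  by move->; rewrite addn0.
case=> D1 flipD; rewrite -addSnnS; apply: IHm; [lia|lia|].
by apply: flipped_fanS flipD; first [lia | assumption].
Qed.
End FanFlips.

(** * Single steps in the auxiliary graph and the list of super T-paths *)

Lemma crossing_from_vertex k e j y : (2 <= j)%N -> is_gedge k e ->
  crossing k e != None -> joins e (inl j) y ->
  [/\ e = Arc 1 j, y = inl 1%N & (3 <= j < k)%N].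
Proof.
move=> j2; case: e => [a b|a|a b] //= ge.
  case: ifP => //= /andP[/eqP-> hb] _ /orP[] /eqP[]; first by lia.
  by move=> <- <-; split=> //; lia.
by move=> _ /orP[] /eqP[] // _ ?; lia.
Qed.

(** All crossing edges end at vertex 1, so an even step from any other vertex is forced and leads
    there. *)
Lemma crossing_from_theta k e i y : crossing k e != None ->
  joins e (inr i) y -> e = Sigma i /\ y = inl 1%N.
Proof. by case: e => [a b|a|a b] //= _ /orP[] /eqP[] // -> <-. Qed.

Lemma crossing_from_one k e y : is_gedge k e ->
  crossing k e != None -> joins e (inl 1%N) y ->
  (exists2 j, (3 <= j < k)%N & e = Arc 1 j /\ y = inl j) \/
  (exists2 i, (1 <= i <= k - 2)%N & e = Sigma i /\ y = inr i).
Proof.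
case: e => [a b|a|a b] //= ge.
  case: ifP => //= /andP[/eqP-> hb] _ /orP[] /eqP[]; last by lia.
  by move=> <-; left; exists b => //; lia.
by move=> _ /orP[] /eqP[] // <-; right; exists a.
Qed.

Lemma odd_step_from_one k e y : is_gedge k e -> ~~ is_sigma e ->
  joins e (inl 1%N) y ->
  exists2 j, (2 <= j <= k)%N & e = Arc 1 j /\ y = inl j.
Proof.
case: e => [a b|a|a b] //= ge _ /orP[] /eqP[] //; last by move=> ? ?; lia.
by move=> a1 <-; exists b; rewrite ?a1 //; lia.
Qed.

Lemma odd_step_from_vertex k e j y : (2 <= j)%N -> is_gedge k e ->
  ~~ is_sigma e -> joins e (inl j) y ->
  [\/ e = Arc 1 j /\ y = inl 1%N,
      e = Arc j j.+1 /\ y = inl j.+1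
    | (3 <= j)%N /\ e = Arc j.-1 j /\ y = inl j.-1].
Proof.
move=> j2; case: e => [a b|a|a b] //= ge _ /orP[] /eqP[] //.
  by move=> aj <-; constructor 2; have -> : b = j.+1 by [lia]; rewrite aj.
move=> <- bj; have [->|a1] := eqVneq a 1%N; first by constructor 1; rewrite bj.
by constructor 3; have -> : a = j.-1 by [lia]; rewrite bj; split; first lia.
Qed.

(** The backward alternative is kept coarse: the order of the crossings rules it out later. *)
Lemma odd_step_from_theta k e i y : is_gedge k e -> ~~ is_sigma e ->
  joins e (inr i) y ->
  (exists2 j, (i < j <= k - 2)%N & e = Tau i j /\ y = inr j) \/
  (exists2 j, (j < i)%N & y = inr j).
Proof.
case: e => [a b|a|a b] //= ge _ /orP[] /eqP[] //.
  by move=> ai <-; left; exists b; rewrite ?ai //; lia.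
by move=> <- bi; right; exists a => //; lia.
Qed.

(** The generic path reaches the side of [Delta i] opposite to vertex 1 through (1,i+1) and returns
    through (1,i+2). For [i = 1] the initial detour 2, 1, 2 is cut; for [i = k - 2], the final
    detour k, 1, k. *)
Definition fan_Tpath k i : Tpath :=
  if i == 1%N then
    ([:: inl 2; inl 3; inl 1; inl k], [:: Arc 2 3; Arc 1 3; Arc 1 k])%N
  else if i.+2 == k then
    ([:: inl 2; inl 1; inl i.+1; inl k],
     [:: Arc 1 2; Arc 1 i.+1; Arc i.+1 i.+2])%N
  else
    ([:: inl 2; inl 1; inl i.+1; inl i.+2; inl 1; inl k],
     [:: Arc 1 2; Arc 1 i.+1; Arc i.+1 i.+2; Arc 1 i.+2; Arc 1 k])%N.

Definition sigma_Tpath k i j : Tpath :=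
  ([:: inl 2; inl 1; inr i; inr j; inl 1; inl k],
   [:: Arc 1 2; Sigma i; Tau i j; Sigma j; Arc 1 k])%N.

Definition Tpaths k : seq Tpath :=
  [seq fan_Tpath k i | i <- index_iota 1 k.-1] ++
  [seq sigma_Tpath k i j | j <- index_iota 1 k.-1, i <- index_iota 1 j].

(** Identifies [w] once its length and its individual vertices and steps are known. *)
Lemma Tpath_eta (w : Tpath) : size w.1 = (size w.2).+1 ->
  w = (mkseq (tvert w) (size w.2).+1,
       mkseq (fun s => tstep w s.+1) (size w.2)).
Proof. by case: w => v e /= sz; rewrite -sz !mkseq_nth. Qed.

(** * Every super T-path is in the list *)

Section TpathClassification.
Context (k : nat) (w : Tpath) (k4 : (4 <= k)%N) (Pw : super_Tpath_gen k w).

Lemma tstep_neq s t : (0 < s < t)%N -> (t <= size w.2)%N ->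
  tstep w s <> tstep w t.
Proof.
move=> st tN /eqP; rewrite nth_uniq ?(Tpath_uniq Pw) //; first lia.
  by apply: leq_trans tN; lia.
by apply: leq_trans tN; lia.
Qed.

Lemma odd_step s : ~~ odd s -> (s < size w.2)%N ->
  [/\ is_gedge k (tstep w s.+1), ~~ is_sigma (tstep w s.+1)
    & joins (tstep w s.+1) (tvert w s) (tvert w s.+1)].
Proof.
move=> os sN; have /andP[-> ->] := Tpath_edges Pw (s := s.+1) sN; split=> //.
by apply/negP => /(Tpath_sigma Pw (s := s.+1) sN) /=; rewrite os.
Qed.

Lemma even_step s : odd s -> (s < size w.2)%N ->
  [/\ is_gedge k (tstep w s.+1), crossing k (tstep w s.+1) != None
    & joins (tstep w s.+1) (tvert w s) (tvert w s.+1)].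
Proof.
move=> os sN; have /andP[-> ->] := Tpath_edges Pw (s := s.+1) sN; split=> //.
by apply: (Tpath_cross Pw) => //=; rewrite negbK.
Qed.

Lemma last_step_from_one s : ~~ odd s -> (s < size w.2)%N ->
  tvert w s = inl 1%N -> size w.2 = s.+1 /\ tstep w s.+1 = Arc 1 k.
Proof.
move=> os sN v1; have [ge ns] := odd_step os sN; rewrite v1.
case/(odd_step_from_one ge ns) => j jk [eE vE].
have [sN1|sN1] := eqVneq (size w.2) s.+1.
  by split=> //; have := Tpath_end Pw; rewrite sN1 vE eE => -[->].
have {}sN1 : (s.+1 < size w.2)%N by lia.
have [ge' cr'] := even_step (s := s.+1) os sN1; rewrite vE => jn.
(* The next step is even and starts at [j], so it would repeat [Arc 1 j]. *)
have [|eE' _ _] := crossing_from_vertex _ ge' cr' jn; first lia.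
by case: (@tstep_neq s.+1 s.+2) => //; rewrite ?eE //; lia.
Qed.

Lemma Tpath_mem : w \in Tpaths k.
Proof.
have oN := Tpath_odd Pw; have vN := Tpath_end Pw.
have v0 := Tpath_start Pw; have wE := Tpath_eta (Tpath_size Pw).
(* After an odd number of steps not ending at [k], the odd total length forces at least two more
   steps. *)
have lt_odd s : odd s -> (s <= size w.2)%N -> tvert w s <> inl k ->
    (s.+1 < size w.2)%N.
  move=> os sN vs; have sN' : s != size w.2 by apply/eqP => se; rewrite se in vs.
  have : s.+1 != size w.2 by apply/eqP => se; move: oN; rewrite -se /= os.
  lia.
have mem_fan i : (1 <= i)%N -> (i.+2 <= k)%N -> fan_Tpath k i \in Tpaths k.
  move=> i1 ik; rewrite mem_cat map_f // mem_index_iota; lia.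
have [ge1 ns1] : is_gedge k (tstep w 1) /\ ~~ is_sigma (tstep w 1).
  by have [] := odd_step (s := 0) isT (odd_gt0 oN).
have [_ _] := odd_step (s := 0) isT (odd_gt0 oN); rewrite v0.
case/(odd_step_from_vertex _ ge1 ns1) => // [[t1 v1]|[t1 v1]|[//]].
(* The first step goes to vertex 1. *)
- have N3 : (2 < size w.2)%N.
    by apply: (lt_odd 1%N) => //; rewrite ?odd_gt0 // v1 => -[]; lia.
  have [ge2 cr2] := even_step (s := 1) isT (ltnW N3); rewrite v1.
  case/(crossing_from_one ge2 cr2) => -[i ik [t2 v2]].
  + have [ge3 ns3] := odd_step (s := 2) isT N3; rewrite v2.
    case/(odd_step_from_vertex _ ge3 ns3); first lia.
    * by case=> t3 _; case: (@tstep_neq 2 3) => //; rewrite t2 t3.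
    (* The third step follows the side (i,i+1) of [Delta i.-1]. If [i.+1 = k], the path ends there,
       since no crossing edge meets [k]. *)
    * case=> t3 v3; have [ik1|ik1] := eqVneq i.+1 k.
        have N3' : size w.2 = 3.
          have [//|N3'] := eqVneq (size w.2) 3; have {}N3' : (3 < size w.2)%N by lia.
          have [ge4 cr4] := even_step (s := 3) isT N3'; rewrite v3.
          by case/(crossing_from_vertex _ ge4 cr4); lia.
        suff -> : w = fan_Tpath k i.-1 by apply: mem_fan; lia.
        rewrite wE N3' /mkseq /= v0 v1 v2 v3 t1 t2 t3 /fan_Tpath ik1.
        by rewrite prednK ?ik1 ?eqxx ?ifF //; lia.
      have N5 : (4 < size w.2)%N.
        by apply: (lt_odd 3) => //; rewrite v3 => -[]; lia.
      have [ge4 cr4] := even_step (s := 3) isT (ltnW N5); rewrite v3.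
      case/(crossing_from_vertex _ ge4 cr4) => [|t4 v4 ik4]; first lia.
      have [NE t5] := last_step_from_one (s := 4) isT N5 v4.
      have v5 := vN; rewrite NE in v5.
      suff -> : w = fan_Tpath k i.-1 by apply: mem_fan; lia.
      rewrite wE NE /mkseq /= v0 v1 v2 v3 v4 v5 t1 t2 t3 t4 t5 /fan_Tpath.
      by rewrite prednK ?(negbTE ik1) ?ifF //; lia.
    (* After a step back to [i.-1], the only possible crossing edge is (1,i-1), which crosses before
       (1,i). *)
    * case=> i3 [t3 v3].
      have N5 : (4 < size w.2)%N.
        by apply: (lt_odd 3) => //; rewrite v3 => -[]; lia.
      have [ge4 cr4] := even_step (s := 3) isT (ltnW N5); rewrite v3.
      case/(crossing_from_vertex _ ge4 cr4) => [|t4 _ ik4]; first lia.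
      have := Tpath_increasing Pw (s := 2) (s' := 4) isT (ltnW N5).
      rewrite t2 t4 /= !ifT; [|lia|lia].
      by move/(_ _ _ erefl erefl); lia.
  (* The second step is [Sigma i]. After a tau-edge to theta_j the return to 1 is [Sigma j], and
     increasing positions give [i < j]. *)
  + have [ge3 ns3] := odd_step (s := 2) isT N3; rewrite v2.
    move=> jn3; have [j v3] : exists j, tvert w 3 = inr j.
      by case: (odd_step_from_theta ge3 ns3 jn3) => -[j _] => [[_]|] ->; exists j.
    have N5 : (4 < size w.2)%N by apply: (lt_odd 3) => //; rewrite v3.
    have [ge4 cr4] := even_step (s := 3) isT (ltnW N5); rewrite v3.
    case/(crossing_from_theta cr4) => t4 v4.
    have := Tpath_increasing Pw (s := 2) (s' := 4) isT (ltnW N5).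
    rewrite t2 t4 => /(_ _ _ erefl erefl) ltij.
    case: (odd_step_from_theta ge3 ns3 jn3) => -[j' ltj']; last first.
      by rewrite v3 => -[ejj']; lia.
    rewrite v3 => -[t3 [ejj']]; rewrite -{j'}ejj' in ltj' t3.
    have [NE t5] := last_step_from_one (s := 4) isT N5 v4.
    have v5 := vN; rewrite NE in v5.
    rewrite mem_cat; apply/orP; right; apply/allpairsPdep; exists j, i.
    rewrite !mem_index_iota; split; [lia|lia|].
    by rewrite wE NE /mkseq /= v0 v1 v2 v3 v4 v5 t1 t2 t3 t4 t5.
(* The first step goes to vertex 3, and the two remaining steps are forced. *)
have N3 : (2 < size w.2)%N.
  by apply: (lt_odd 1%N) => //; rewrite ?odd_gt0 // v1 => -[]; lia.
have [ge2 cr2] := even_step (s := 1) isT (ltnW N3); rewrite v1.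
case/(crossing_from_vertex _ ge2 cr2) => // t2 v2 _.
have [NE t3] := last_step_from_one (s := 2) isT N3 v2.
have v3 := vN; rewrite NE in v3.
suff -> : w = fan_Tpath k 1 by apply: mem_fan; lia.
by rewrite wE NE /mkseq /= v0 v1 v2 v3 t1 t2 t3.
Qed.
End TpathClassification.

(** * The listed paths are super T-paths, each listed once *)

Lemma Arc_eqE a b c d : (Arc a b == Arc c d) = (a == c) && (b == d).
Proof. by apply/eqP/andP => [[-> ->]|[/eqP-> /eqP->]]. Qed.

Lemma Sigma_eqE i j : (Sigma i == Sigma j) = (i == j).
Proof. by apply/eqP/eqP => [[]|->]. Qed.

(** The crossings are at most (1,i+1) and (1,i+2), in this order, with doubled positions 2i - 1 and
    2i + 1; (1,2) and (1,k) do not cross. *)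
Lemma fan_TpathP k i : (4 <= k)%N -> (1 <= i < k.-1)%N ->
  super_Tpath_gen k (fan_Tpath k i).
Proof.
move=> k4 ik; rewrite /fan_Tpath.
have [i1|i1] := eqVneq i 1%N; last have [i2k|i2k] := eqVneq i.+2 k; split=> //=.
- move=> [|[|[|[|s]]]] //= _; rewrite /joins ?eqxx ?orbT ?andbT //=; lia.
- by rewrite !inE ?Arc_eqE ?Sigma_eqE /=; lia.
- by move=> [|[|[|[|s]]]] //= _ _; rewrite ifT //; lia.
- by move=> [|[|[|[|s]]]].
- by move=> [|[|[|[|s]]]].
- by move=> [|[|[|[|s]]]] [|[|[|[|s']]]] x x' //= _ _; do ?(case: ifP => //= ?);
    move=> [<-] [<-]; lia.
- move=> [|[|[|[|s]]]] //= _; rewrite /joins ?i2k ?eqxx ?orbT ?andbT //=; lia.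
- by rewrite !inE ?Arc_eqE ?Sigma_eqE /=; lia.
- by move=> [|[|[|[|s]]]] //= _ _; rewrite ifT //; lia.
- by move=> [|[|[|[|s]]]].
- by move=> [|[|[|[|s]]]].
- by move=> [|[|[|[|s]]]] [|[|[|[|s']]]] x x' //= _ _; do ?(case: ifP => //= ?);
    move=> [<-] [<-]; lia.
- move=> [|[|[|[|[|[|s]]]]]] //= _; rewrite /joins ?eqxx ?orbT ?andbT //=; lia.
- by rewrite !inE ?Arc_eqE ?Sigma_eqE /=; lia.
- by move=> [|[|[|[|[|[|s]]]]]] //= _ _; rewrite ifT //; lia.
- by move=> [|[|[|[|[|[|s]]]]]].
- by move=> [|[|[|[|[|[|s]]]]]].
- by move=> [|[|[|[|[|[|s]]]]]] [|[|[|[|[|[|s']]]]]] x x' //= _ _;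
    do ?(case: ifP => //= ?); move=> [<-] [<-]; lia.
Qed.

Lemma sigma_TpathP k i j : (4 <= k)%N -> (1 <= i < j)%N -> (j < k.-1)%N ->
  super_Tpath_gen k (sigma_Tpath k i j).
Proof.
move=> k4 ij jk; split=> //=.
- move=> [|[|[|[|[|[|s]]]]]] //= _; rewrite /joins ?eqxx ?orbT ?andbT //=; lia.
- by rewrite !inE Arc_eqE Sigma_eqE /=; case: (Sigma i =P Arc 1 k) => //; lia.
- by move=> [|[|[|[|[|[|s]]]]]] //= _ _; rewrite ifT //; lia.
- by move=> [|[|[|[|[|[|s]]]]]].
- by move=> [|[|[|[|[|[|s]]]]]].
- by move=> [|[|[|[|[|[|s]]]]]] [|[|[|[|[|[|s']]]]]] x x' //= _ _;
    do ?(case: ifP => //= ?); move=> [<-] [<-]; lia.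
Qed.

Lemma mem_Tpaths k w : (4 <= k)%N -> w \in Tpaths k <-> super_Tpath_gen k w.
Proof.
move=> k4; split; last exact: Tpath_mem.
rewrite mem_cat => /orP[/mapP[i]|/allpairsPdep[j [i []]]]; rewrite !mem_index_iota.
  by move=> ik ->; apply: fan_TpathP.
by move=> jk ij ->; apply: sigma_TpathP => //; lia.
Qed.

Lemma Tpaths_uniq k : uniq (Tpaths k).
Proof.
rewrite cat_uniq; apply/and3P; split.
- rewrite map_inj_in_uniq ?iota_uniq // => i i'; rewrite !mem_index_iota => ik ik'.
  rewrite /fan_Tpath; do 4?case: eqP => //; by [lia | move=> *; congruence].
- apply/hasPn => w /allpairsPdep[j [i [_ _ ->]]]; apply/mapP => -[l _].
  by rewrite /fan_Tpath; do 2?case: eqP.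
- by apply: allpairs_uniq_dep => [|j _|[j i] [j' i'] _ _ /= [-> ->]] //;
    rewrite iota_uniq.
Qed.

(** * Weights of the listed paths *)

Section TpathWeights.
Context {R : rcfType} {A : unitAlgType R} (SA : superAlgebra A).
Context (n k : nat) (D : decoration A).
Context (k4 : (4 <= k)%N) (kn : (k <= n)%N) (fanD : fan_decoration SA n D).

(** The even steps supply the denominators of [hlen D i]. In the two short paths the absent
    denominator is cancelled by lambda_12 or lambda_1k. *)
Lemma wt_fan_Tpath i : (1 <= i < k.-1)%N ->
  wt_Tpath SA D k (fan_Tpath k i)
  = hlen D i * (lam D [fset 1%N; 2%N] * lam D [fset 1%N; k]).
Proof.
move=> ik; have p1 j : (2 <= j <= k)%N -> is_pos SA (lam D [fset 1%N; j]).
  by move=> jk; apply: (fan_lam1_pos fanD); lia.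
have p12 : is_pos SA (lam D [fset 1%N; 2%N]) by apply: p1; lia.
have pi1 : is_pos SA (lam D [fset 1%N; i.+1]) by apply: p1; lia.
have pi2 : is_pos SA (lam D [fset 1%N; i.+2]) by apply: p1; lia.
have nosigma : forall j, (Sigma j \in (fan_Tpath k i).2) = false.
  by move=> j; apply/negbTE/negP; rewrite /fan_Tpath; do 2?case: eqP => _ /=;
     rewrite !inE; do ?case/orP => /eqP.
rewrite /wt_Tpath [X in _ * X]big_pred0 // mulr1 /hlen /fan_Tpath.
rewrite invrM ?(pos_unit pi1) ?(pos_unit pi2) //.
have [i1|i1] := eqVneq i 1%N; last have [i2k|i2k] := eqVneq i.+2 k.
- rewrite i1 in pi2 *; rewrite unlock /= !mulr1 /=.
  by rewrite -!mulrA mulKr // (pos_unit p12).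
- rewrite unlock /= mulr1 -i2k (pos_comm _ p12) (pos_comm _ (posV pi1)).
  by rewrite (pos_comm _ (posV pi2)) (pos_comm _ p12) -!mulrA mulKr ?(pos_unit pi2).
- rewrite unlock /= mulr1 (pos_comm _ p12) (pos_comm _ (posV pi1)).
  rewrite (pos_comm (lam D [fset 1%N; k]) p12) -!mulrA; do 2 congr (_ * _).
  by rewrite ![_ * (_ * lam D [fset 1%N; 2%N])]mulrA (pos_comm _ (posV pi1)).
Qed.

Lemma wt_sigma_Tpath i j : (1 <= i < j)%N -> (j < k.-1)%N ->
  wt_Tpath SA D k (sigma_Tpath k i j)
  = wt_sigma SA D i * wt_sigma SA D j
    * (lam D [fset 1%N; 2%N] * lam D [fset 1%N; k]).
Proof.
move=> ij jk; rewrite /wt_Tpath -[X in _ * X]big_filter.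
(* Two strictly increasing lists with the same members agree, so the odd factors occur in the order
   [i], [j]. *)
have -> : [seq l <- index_iota 1 k.-1 | Sigma l \in (sigma_Tpath k i j).2]
    = [:: i; j].
  apply: (irr_sorted_eq ltn_trans ltnn).
  - by rewrite sorted_filter ?iota_ltn_sorted //; apply: ltn_trans.
  - by rewrite /=; lia.
  move=> l; rewrite mem_filter mem_index_iota !inE !Sigma_eqE /=.
  by case: (Sigma l =P Arc 1 2) => //; case: (Sigma l =P Arc 1 k) => //; lia.
rewrite unlock /= !mul1r !mulr1 (pos_comm (SA := SA)) // posM //.
  by apply: (fan_lam1_pos fanD); lia.
by apply: (fan_lam1_pos fanD); lia.
Qed.

Lemma sum_wt_Tpaths :
  \sum_(w <- Tpaths k) wt_Tpath SA D k w
  = (\sum_(1 <= i < k.-1) hlen D i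
     + \sum_(1 <= j < k.-1) \sum_(1 <= i < j) wt_sigma SA D i * wt_sigma SA D j)
    * (lam D [fset 1%N; 2%N] * lam D [fset 1%N; k]).
Proof.
rewrite big_cat big_map big_allpairs_dep /= mulrDl !mulr_suml.
congr (_ + _); apply: eq_big_nat => j jk; first exact: wt_fan_Tpath.
rewrite mulr_suml; apply: eq_big_nat => i ij; apply: wt_sigma_Tpath; lia.
Qed.
End TpathWeights.

(** * Comparison of the flips with the T-paths *)

Theorem theorem6p4 (R : rcfType) (A : unitAlgType R) (SA : superAlgebra A)
    (n k : nat) (D0 D : decoration A)
    (hn : (3 <= n)%N) (hk : (3 <= k <= n)%N)
    (hfan : fan_decoration SA n D0)
    (hflips : super_flips SA D0 [seq [fset 1%N; j] | j <- iota 3 (k - 3)] D) :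
  ssqrt SA (lam D [fset 2%N; k] / (lam D0 [fset 1%N; 2%N] * lam D0 [fset 1%N; k]))
    * mu D [fset 1%N; 2%N; k]
  = \sum_(1 <= i < k.-1) wt_sigma SA D0 i
  /\
  exists T : {fset Tpath},
    (forall w : Tpath, w \in T <-> super_Tpath k w) /\
    lam D [fset 2%N; k] = \sum_(w <- T) wt_Tpath SA D0 k w.
Proof.
(* The [k - 3] flips lead from stage 2 to stage [k - 1], whose newest arc is (2,k). *)
have kE : k = (2 + (k - 3)).+1 by lia.
have FD : flipped_fan SA n D0 k.-1 D.
  rewrite kE /=; apply: super_flips_flipped_fan hflips => //; first lia.
  exact: flipped_fan0.
have [_ _ _ _ _ _ _ lam2E mu2E] := FD.
rewrite prednK in lam2E mu2E; last lia.
split; first exact: mu2E.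
have p1 j : (2 <= j <= n)%N -> is_pos SA (lam D0 [fset 1%N; j]).
  exact: fan_lam1_pos hfan.
have p12k : is_pos SA (lam D0 [fset 1%N; 2%N] * lam D0 [fset 1%N; k]).
  by apply: posM; apply: p1; lia.
(* For [k = 3] the single path is prescribed separately, and no flip was made. *)
have [k3|k3] := eqVneq k 3.
  exists [fset ([:: inl 2%N; inl 3%N], [:: Arc 2 3]) : Tpath]; split.
    by move=> w; rewrite inE /super_Tpath k3 /=; split=> /eqP.
  move: hflips; rewrite k3 /= => ->.
  by rewrite big_seq_fset1 /wt_Tpath /= big_nat1 /= big_pred0 ?mulr1 //.
have k4 : (4 <= k)%N by lia.
have memT w : (w \in [fset x in Tpaths k]) = (w \in Tpaths k).
  by apply/imfsetP/idP => [[x xT ->] //|wT]; exists w.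
exists [fset x in Tpaths k]; split.
  by move=> w; rewrite memT /super_Tpath (negbTE k3); apply: mem_Tpaths.
(* The finite set may be summed in the order of the list, which has no repetitions. *)
rewrite (perm_big (Tpaths k)) /=; last first.
  by apply: uniq_perm; rewrite ?fset_uniq ?Tpaths_uniq.
rewrite (sum_wt_Tpaths k4 _ hfan); last lia.
by rewrite -lam2E divrK // (pos_unit p12k).
Qed.
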